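(* (a) For every integer $n\ge 2$ there exists a graph on $2^{\lfloor (n-2)/2\rfloor}$ vertices that has neither an $n$-clique nor an $n$-anticlique. (b) For all integers $n\ge 2$ and $k\ge 1$ there exists a coloring of the edges of the complete graph on $k^{\lfloor (n-2)/2\rfloor}$ vertices in $k$ colors for which there is no monochromatic $n$-clique. (c) For all integers $n\ge 2$, $k\ge 1$ and $l$ with $1\le l\le n$ there exists a coloring in $k$ colors of all $l$-element subsets of a set of $k^{\lfloor (n-l+1)^{l-1}/l!\rfloor}$ elements for which there is no monochromatic $n$-hyperclique.
   Context: Graphs are finite and simple. An $n$-clique (respectively $n$-anticlique) of a graph is a complete (respectively empty, i.e. edgeless) subgraph on $n$ vertices of the given graph, that is, a set of $n$ distinct vertices any two of which are adjacent (respectively no two of which are adjacent). For a fixed $l$, an $n$-hyperclique in a set is the family of all $l$-element subsets of a given $n$-element subset of that set. A coloring in $k$ colors is a map to a set of $k$ colors (not required to be surjective). A clique in an edge-colored complete graph is monochromatic if all its edges have the same color; a hyperclique is monochromatic if all the $l$-element subsets in it have the same color. *)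

(* Defs.v *)
From mathcomp Require Import all_boot.

Set Implicit Arguments.
Unset Strict Implicit.
Unset Printing Implicit Defensive.

Record sgraph := SGraph {
  vertex :> finType;
  adj : rel vertex;
  adj_sym : symmetric adj;
  adj_irrefl : irreflexive adj }.

Definition n_clique (G : sgraph) (n : nat) (S : {set G}) : bool :=
  (#|S| == n) && [forall x in S, forall y in S, (x != y) ==> adj x y].

Definition n_anticlique (G : sgraph) (n : nat) (S : {set G}) : bool :=
  (#|S| == n) && [forall x in S, forall y in S, ~~ adj x y].

Definition edges (G : sgraph) : {set {set G}} :=
  [set [set p.1; p.2] | p in [pred p : G * G | adj p.1 p.2]].

Definition edge (G : sgraph) : finType := {e : {set G} | e \in edges G}.

Fact neq_sym (T : finType) : symmetric (fun x y : T => x != y).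
Proof. by move=> x y; rewrite eq_sym. Qed.

Fact neq_irrefl (T : finType) : irreflexive (fun x y : T => x != y).
Proof. by move=> x; rewrite eqxx. Qed.

Definition complete_graph (N : nat) : sgraph :=
  SGraph (@neq_sym 'I_N) (@neq_irrefl 'I_N).

Definition mono_clique (G : sgraph) (k : nat) (c : edge G -> 'I_k)
    (S : {set G}) : Prop :=
  forall e f : edge G, val e \subset S -> val f \subset S -> c e = c f.

Definition lsubset (T : finType) (l : nat) : finType :=
  {A : {set T} | #|A| == l}.

Definition n_hyperclique (T : finType) (l n : nat) (F : {set {set T}}) : Prop :=
  exists2 S : {set T}, #|S| = n & F = [set A : {set T} | A \subset S & #|A| == l].

Definition mono_hyperclique (T : finType) (l k : nat)
    (c : lsubset T l -> 'I_k) (F : {set {set T}}) : Prop :=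
  forall A B : lsubset T l, val A \in F -> val B \in F -> c A = c B.

(* Main.v *)
Require Import Defs.
From mathcomp Require Import all_boot zify.

Set Implicit Arguments.
Unset Strict Implicit.
Unset Printing Implicit Defensive.

(** Part (c) contains the other two: for [l = 2] its exponent is the integer
    part of [(n - 1) / 2], which is at least that of (b), and a coloring of
    edges in two colors is a graph, with cliques of one color and anticliques
    of the other.

    For (c), write [e] for the exponent and [N = k ^ e].  When the [l]-subsets
    of an [N]-set are colored uniformly at random, the expected number of
    monochromatic [n]-hypercliques is [k * 'C(N, n) / k ^ 'C(n, l)], so
    a good coloring exists if this is less than 1 ([avoids_random]).  Since
    ['C(N, n) <= k ^ (e * n) / n`!] and [e * n <= 'C(n, l)], the expectation is
    at most [k / n`!], which settles the case [k < n`!].  When [l > 2] the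
    inequality [e * n < 'C(n, l)] is strict, which gains a factor [k] and
    settles every [k].

    There remain [l = 1] and [l = 2] with many colors, where explicit colorings
    are available.  For [l = 1] there are at most as many points as colors, and
    the points can get distinct colors.  For [l = 2] the vertices are placed in
    [{0, ..., n - 2} ^ k] and an edge gets as color a coordinate in which its
    ends differ: [n] points cannot be pairwise distinct in the same coordinate
    ([avoids_coordinates]).  This handles [(n - 1) ^ k] vertices, which is
    enough as soon as [k >= e] ([expn_leq_double_expn]). *)

(** * A union bound *)

Lemma leq_card_bigcup (I T : finType) (P : pred I) (F : I -> {set T}) :
  #|\bigcup_(i | P i) F i| <= \sum_(i | P i) #|F i|.
Proof.
elim/big_rec2: _ => [|i m A _ leA]; first by rewrite cards0.
by apply: leq_trans (leq_card_setU _ _) _; rewrite leq_add2l.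
Qed.

(** For fixed [E] in [H] and fixed color [i], exactly one in [k ^ M] of all
    colorings of [X] has constant value [i] on [E]; summing over the [#|H| * k]
    pairs, the bad colorings are fewer than all colorings. *)
Lemma exists_nonconstant_coloring (X : finType) (k M : nat)
    (H : {set {set X}}) :
  0 < k -> (forall E : {set X}, E \in H -> #|E| = M) -> #|H| * k < k ^ M ->
  exists f : {ffun X -> 'I_k},
    forall E i, E \in H -> exists2 x, x \in E & f x != i.
Proof.
move=> k0 cardH ltHk.
pose bad (E : {set X}) (i : 'I_k) := [set f : {ffun X -> 'I_k} | [forall x in E, f x == i]].
have card_bad E i : E \in H -> #|bad E i| * k ^ M = k ^ #|X|.
  move=> EH.
  have -> : #|bad E i|
      = #|family (fun x => if x \in E then pred1 i else predT)|.
    apply: eq_card => f; rewrite inE; apply/forallP/familyP => fE x;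
      have := fE x; by case: ifP => //; rewrite inE.
  rewrite card_family foldrE big_map big_enum /=.
  rewrite (bigID (mem E)) /= big1 => [|x xE]; last by rewrite xE card1.
  under eq_bigr => x xE do rewrite (negPf xE) cardT size_enum_ord.
  rewrite prod_nat_const mul1n -expnD -(cardH E EH); congr (_ ^ _).
  by rewrite addnC -(cardC (mem E)).
pose B := \bigcup_(E in H) \bigcup_(i : 'I_k) bad E i.
have cardB : #|B| * k ^ M <= #|H| * k * k ^ #|X|.
  have leB : #|B| <= \sum_(E in H) \sum_(i : 'I_k) #|bad E i|.
    apply: leq_trans (leq_card_bigcup _ _) _.
    by apply: leq_sum => E _; apply: leq_card_bigcup.
  apply: leq_trans (leq_mul leB (leqnn _)) _.
  rewrite big_distrl /= -mulnA -sum_nat_const; apply: leq_sum => E EH.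
  rewrite big_distrl /= (eq_bigr (fun=> k ^ #|X|)) => [|i _]; last exact: card_bad.
  by rewrite sum_nat_const card_ord.
have ltB : #|B| < #|{ffun X -> 'I_k}|.
  rewrite card_ffun card_ord -(@ltn_pmul2r (k ^ M)) ?expn_gt0 ?k0 //.
  apply: leq_ltn_trans cardB _.
  by rewrite mulnC ltn_pmul2l // expn_gt0 k0.
have [f fB] : exists f, f \notin B.
  apply/existsP; rewrite -negb_forall; apply: contraL ltB => /forallP allB.
  by rewrite -leqNgt; apply/subset_leq_card/subsetP => f _; apply: allB.
exists f => E i EH; apply/exists_inP; rewrite -[X in is_true X]negbK negb_exists_in.
apply: contra fB => /forall_inP fE.
apply/bigcupP; exists E => //; apply/bigcupP; exists i => //.
by rewrite inE; apply/forall_inP => x xE; have := fE x xE; rewrite negbK.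
Qed.

(** * Colorings without monochromatic hypercliques *)

(** The coloring is defined on all subsets of [T] to avoid dependent types; only
    its values on [l]-subsets matter.  Quantifying over the color [i], instead of
    asking for two [l]-subsets of different colors, makes the counting direct;
    the two forms agree when [S] has an [l]-subset. *)
Definition avoids {T : finType} {k : nat} (l n : nat)
    (c : {set T} -> 'I_k) : Prop :=
  forall (S : {set T}) (i : 'I_k), #|S| = n ->
    exists A : {set T}, [/\ A \subset S, #|A| = l & c A != i].

Lemma avoids_random (N k l n : nat) :
  0 < k -> 'C(N, n) * k < k ^ 'C(n, l) ->
  exists c : {set 'I_N} -> 'I_k, avoids l n c.
Proof.
move=> k0 ltk.
pose lsets (S : {set 'I_N}) := [set A : {set 'I_N} | A \subset S & #|A| == l].
have [||c cP] := @exists_nonconstant_coloring _ k 'C(n, l)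
    (lsets @: [set S : {set 'I_N} | #|S| == n]) k0.
- by move=> _ /imsetP[S + ->]; rewrite inE => /eqP <-; apply: cards_draws.
- apply: leq_ltn_trans ltk; rewrite leq_mul2r; apply/orP; right.
  apply: leq_trans (leq_imset_card _ _) _.
  by rewrite card_draws card_ord.
exists c => S i cardS.
have /(cP _ i)[A] : lsets S \in lsets @: [set S : {set 'I_N} | #|S| == n].
  by apply: imset_f; rewrite inE cardS.
by rewrite inE => /andP[AS /eqP cardA] cA; exists A.
Qed.

Lemma avoids_injective (N k n : nat) :
  0 < k -> 1 < n -> N <= k -> exists c : {set 'I_N} -> 'I_k, avoids 1 n c.
Proof.
move=> k0 n1 leNk.
pose c (A : {set 'I_N}) : 'I_k :=
  if [pick x in A] is Some x then widen_ord leNk x else Ordinal k0.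
have c1 x : c [set x] = widen_ord leNk x.
  rewrite /c; case: pickP => [y /set1P -> //|/(_ x)].
  by rewrite inE eqxx.
exists c => S i cardS.
have /card_gt1P[x [y [xS yS neqxy]]] : 1 < #|S| by rewrite cardS.
have [cxi|] := eqVneq (c [set x]) i; last first.
  by exists [set x]; rewrite sub1set cards1.
exists [set y]; rewrite sub1set cards1; split=> //.
by apply: contraNneq neqxy; rewrite -cxi !c1 => /(congr1 val) /= /val_inj->.
Qed.

(** The points are embedded in the functions from [k] coordinates to [d] values,
    and [c] assigns to a pair a coordinate separating it.  Any choice of such
    a coordinate will do: among [d + 1] points two agree in coordinate [i], so
    their pair does not have color [i]. *)
Lemma avoids_coordinates (N k d : nat) :
  0 < k -> N <= d ^ k -> exists c : {set 'I_N} -> 'I_k, avoids 2 d.+1 c.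
Proof.
move=> k0 leN.
have leNf : N <= #|{ffun 'I_k -> 'I_d}| by rewrite card_ffun !card_ord.
pose f (x : 'I_N) : {ffun 'I_k -> 'I_d} := enum_val (widen_ord leNf x).
have injf : injective f.
  by move=> x y /enum_val_inj /(congr1 val) /= /val_inj.
pose c (A : {set 'I_N}) : 'I_k := odflt (Ordinal k0)
  [pick i | [exists x in A, exists y in A, f x i != f y i]].
exists c => S i cardS.
have /dinjectivePn[x xS [y /andP[/= neqyx yS] eqfi]] :
    ~~ dinjectiveb (fun x => f x i) (mem S).
  apply/negP => /dinjectiveP inj.
  have := max_card [set f x i | x in S].
  by rewrite card_in_imset // cardS card_ord ltnn.
exists [set x; y]; split.
- by rewrite subUset !sub1set xS.
- by rewrite cards2 eq_sym neqyx.
rewrite /c; case: pickP => [j /exists_inP[u uA /exists_inP[v vA neqf]]|none] /=.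
  apply: contraNneq neqf => ->.
  by case/set2P: uA => ->; case/set2P: vA => ->; rewrite ?eqfi.
case/negP: neqyx; apply/eqP/injf/ffunP => j.
apply/eqP/negPn/negP => neqf; have /negP[] := negbT (none j).
apply/exists_inP; exists y; rewrite ?set22 //.
by apply/exists_inP; exists x; rewrite ?set21.
Qed.

(** * Numerical estimates *)

Lemma expn_leq_ffact (d j : nat) : d.+1 ^ j <= (d + j) ^_ j.
Proof.
elim: j => // j IHj; rewrite addnS ffactSS expnS.
by apply: leq_mul => //; rewrite ltnS leq_addr.
Qed.

(** After multiplication by [l`!] the right side becomes the falling factorial
    [n * (n - 1) * ... * (n - l + 1)] with [n = d + l]: each of the [l - 1]
    factors after the first is at least [n - l + 1 = d + 1]. *)
Lemma exponent_leq_bin (d l : nat) :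
  0 < l -> d.+1 ^ l.-1 %/ l`! * (d + l) <= 'C(d + l, l).
Proof.
case: l => // l _; rewrite -(@leq_pmul2r l.+1`!) ?fact_gt0 // bin_ffact.
rewrite mulnAC addnS ffactSS mulnC leq_mul2l /=.
exact: leq_trans (leq_divM _ _) (expn_leq_ffact _ _).
Qed.

(** For [l > 2] the factor [n - 1] of the falling factorial is larger than
    [d + 1 = n - l + 1]. *)
Lemma exponent_ltn_bin (d l : nat) :
  2 < l -> d.+1 ^ l.-1 %/ l`! * (d + l) < 'C(d + l, l).
Proof.
case: l => [|[|[|l]]] // _; rewrite -(@ltn_pmul2r l.+3`!) ?fact_gt0 // bin_ffact.
rewrite mulnAC addnS ffactSS mulnC ltn_mul2l /=.
apply: leq_ltn_trans (leq_divM _ _) _; rewrite addnS ffactSS expnS.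
apply: leq_ltn_trans (leq_mul (leqnn _) (expn_leq_ffact d l.+1)) _.
by rewrite ltn_mul2r ffact_gt0; lia.
Qed.

(** Let [q] be the quotient of [k] by [2 * e].  Then [k <= 2 * e * (q + 1)] and
    [q + 1 <= 2 ^ q <= (2 * e) ^ q], so that [k ^ e <= (2 * e) ^ (e + q * e)], and
    [e + q * e <= k] because [q * e <= k / 2], with [e <= q * e] unless [q = 0]. *)
Lemma expn_leq_double_expn (e k : nat) :
  0 < e -> e <= k -> k ^ e <= e.*2 ^ k.
Proof.
move=> e0 leek; set q := k %/ e.*2.
have e20 : 0 < e.*2 by rewrite double_gt0.
have ltk : k <= e.*2 * q.+1 by rewrite ltnW // mulnC ltn_ceil.
have leqk : e + q * e <= k.
  case: (posnP q) => [-> | q0]; first by rewrite addn0.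
  have : q * e.*2 <= k by apply: leq_divM.
  nia.
have leq2 : q.+1 <= e.*2 ^ q.
  apply: leq_trans (ltn_expl q (ltnSn 1)) _.
  by case: (q) => // q'; rewrite leq_exp2r // (leq_double 1).
apply: leq_trans (leq_pexp2l e20 leqk).
rewrite expnD expnM -expnMn; apply: leq_trans (_ : (e.*2 * q.+1) ^ e <= _).
  by rewrite leq_exp2r.
by rewrite leq_exp2r // leq_mul2l leq2 orbT.
Qed.

Lemma bin_mul_fact_leq (N n k e : nat) :
  N <= k ^ e -> 'C(N, n) * n`! <= k ^ (e * n).
Proof.
move=> leN; rewrite bin_ffact expnM.
have leffact m j : m ^_ j <= m ^ j.
  elim: j m => // j IHj m; rewrite ffactnS expnS leq_mul2l.
  apply/orP; right; apply: leq_trans (IHj _) _.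
  by case: j {IHj} => // j; rewrite leq_exp2r // leq_pred.
apply: leq_trans (leffact _ _) _.
by case: n => // n; rewrite leq_exp2r.
Qed.

(** * The bound for hypercliques *)

Lemma exists_avoiding_coloring (N k l n : nat) :
  1 < n -> 0 < k -> 0 < l <= n ->
  N <= k ^ ((n - l + 1) ^ (l - 1) %/ l`!) ->
  exists c : {set 'I_N} -> 'I_k, avoids l n c.
Proof.
move=> n1 k0 /andP[l0 lelen]; have [d def_n] : exists d, n = d + l.
  by exists (n - l); rewrite subnK.
rewrite subn1 def_n addnK addn1 -def_n; set e := _ %/ _ => leN.
have lee : e * n <= 'C(n, l) by rewrite def_n; apply: exponent_leq_bin.
have binN := @bin_mul_fact_leq N n k e leN.
(* Here the factor n`! lost in passing from 'C(N, n) to N ^ n pays for k. *)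
have [ltkn|lenk] := ltnP k n`!.
  apply: avoids_random => //.
  have [->|C0] := posnP 'C(N, n); first by rewrite mul0n expn_gt0 k0.
  apply: leq_trans (leq_pexp2l k0 lee); apply: leq_trans binN.
  by rewrite ltn_pmul2l.
case: (ltngtP l 2) => [lt2|gt2|l2].
- have l1 : l = 1 by lia.
  move: leN; rewrite /e l1 divn1 => leN.
  exact: avoids_injective.
- apply: avoids_random => //.
  have lte : e * n < 'C(n, l) by rewrite def_n; apply: exponent_ltn_bin.
  apply: leq_trans (leq_pexp2l k0 lte); rewrite expnS mulnC ltn_pmul2l //.
  have [->|C0] := posnP 'C(N, n); first by rewrite expn_gt0 k0.
  apply: leq_trans binN; rewrite ltn_Pmulr //.
  by apply: leq_trans n1 (fact_geq n).
have def_e : e = d.+1./2 by rewrite /e l2 expn1 divn2.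
have def_d : n = d.+2 by rewrite def_n l2 addn2.
rewrite l2 def_d; apply: avoids_coordinates => //; apply: leq_trans leN _.
have [->|e0] := posnP e; first by rewrite expn_gt0.
have lenk' : n <= k by apply: leq_trans lenk; apply: fact_geq.
apply: leq_trans (expn_leq_double_expn e0 _) _; first by lia.
by rewrite leq_exp2r // def_e; lia.
Qed.

(** * Graphs and edge colorings *)

Lemma exists_avoiding_edge_coloring (n k : nat) :
  1 < n -> 0 < k ->
  exists c : {set 'I_(k ^ ((n - 2) %/ 2))} -> 'I_k, avoids 2 n c.
Proof.
move=> n1 k0; apply: exists_avoiding_coloring => //.
by rewrite leq_pexp2l // expn1 leq_div2r // leq_addr.
Qed.

Theorem mainTheorem1 :
  (forall n : nat, 2 <= n ->
     exists G : sgraph,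
       [/\ #|G| = 2 ^ ((n - 2) %/ 2),
           ~ (exists S : {set G}, n_clique n S)
         & ~ (exists S : {set G}, n_anticlique n S)])
  /\
  (forall n k : nat, 2 <= n -> 1 <= k ->
     exists c : edge (complete_graph (k ^ ((n - 2) %/ 2))) -> 'I_k,
       ~ (exists S : {set complete_graph (k ^ ((n - 2) %/ 2))},
            n_clique n S /\ mono_clique c S))
  /\
  (forall n k l : nat, 2 <= n -> 1 <= k -> 1 <= l <= n ->
     exists c : lsubset 'I_(k ^ ((n - l + 1) ^ (l - 1) %/ l`!)) l -> 'I_k,
       ~ (exists F : {set {set 'I_(k ^ ((n - l + 1) ^ (l - 1) %/ l`!))}},
            n_hyperclique l n F /\ mono_hyperclique c F)).
Proof.
split; [|split].
- move=> n n1; have [c cP] := @exists_avoiding_edge_coloring n 2 n1 isT.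
  pose adjc x y := (x != y) && (c [set x; y] == ord0).
  have symc : symmetric adjc by move=> x y; rewrite /adjc eq_sym setUC.
  have irrc : irreflexive adjc by move=> x; rewrite /adjc eqxx.
  exists (SGraph symc irrc); split; first by rewrite /= card_ord.
    case=> S /andP[/eqP cardS /forall_inP clS].
    have [A [AS /eqP/cards2P[x [y [neqxy defA]]]]] := cP S ord0 cardS.
    rewrite defA; move: AS; rewrite defA subUset !sub1set => /andP[xS yS].
    have /forall_inP/(_ y yS)/implyP/(_ neqxy)/andP[_ ->] // := clS x xS.
  case=> S /andP[/eqP cardS /forall_inP clS].
  have [A [AS /eqP/cards2P[x [y [neqxy defA]]]]] := cP S ord_max cardS.
  rewrite defA; move: AS; rewrite defA subUset !sub1set => /andP[xS yS].
  have /forall_inP/(_ y yS) := clS x xS; rewrite /= /adjc neqxy /=.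
  by case: (c _) => [[|[|]]].
- move=> n k n1 k0; have [c cP] := @exists_avoiding_edge_coloring n k n1 k0.
  exists (fun e => c (val e)) => -[S [/andP[/eqP cardS _] monoS]].
  have edgeP (A : {set 'I_(k ^ ((n - 2) %/ 2))}) :
      #|A| = 2 -> A \in edges (complete_graph (k ^ ((n - 2) %/ 2))).
    move=> /eqP/cards2P[x [y [neqxy ->]]].
    by apply/imsetP; exists (x, y); rewrite ?inE.
  have [A [AS cardA _]] := cP S (Ordinal k0) cardS.
  have [B [BS cardB /eqP[]]] := cP S (c A) cardS.
  exact: (monoS (Sub B (edgeP B cardB)) (Sub A (edgeP A cardA))).
- move=> n k l n1 k0 lln.
  have [c cP] := @exists_avoiding_coloring _ k l n n1 k0 lln (leqnn _).
  exists (fun A => c (val A)) => -[_ [[S cardS ->] monoS]].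
  have [A [AS /eqP cardA _]] := cP S (Ordinal k0) cardS.
  have [B [BS /eqP cardB /eqP[]]] := cP S (c A) cardS.
  by apply: (monoS (Sub B cardB) (Sub A cardA)); rewrite inE /= ?AS ?BS.
Qed.
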